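(* Let $n\ge d\ge 1$ be integers and let $\mathcal{C}_{d,n}(x_1,\ldots,x_n)=\sum_{I\subseteq[n],\,|I|=d}\prod_{i\in I}x_i$ be the sum over $\mathrm{GF}(2)$ of all degree-$d$ monomials in the variables $x_1,\ldots,x_n$. Then: (1) if $d$ is odd, $\mathrm{lrank}(\mathcal{C}_{d,n})=1$; (2) if $d$ is even, $\mathrm{lrank}(\mathcal{C}_{d,n})=\lfloor n/2\rfloor-\frac{d}{2}+1$, i.e. it equals $\frac{n-d}{2}+1$ if $n$ is even and $\frac{n-d-1}{2}+1$ if $n$ is odd.
   Context: Every function $f:\{0,1\}^n\to\{0,1\}$ has a unique multilinear polynomial representation over $\mathrm{GF}(2)$; $\deg_2(f)$ denotes its degree. For an affine subspace $H=a+V$ of $\mathrm{GF}(2)^n$, the restriction $f|_H$ is viewed as a function on $H$ (identified with $\mathrm{GF}(2)^{\dim V}$ via any affine bijection; the $\mathrm{GF}(2)$-degree does not depend on the choice). For $f$ with $\deg_2(f)=d\ge1$, the linear rank is $\mathrm{lrank}(f)=\min\{\mathrm{codim}(H): H \text{ affine subspace},\ \deg_2(f|_H)<\deg_2(f)\}$. Note that $\mathrm{lrank}$ of a polynomial depends only on its degree-$d$ monomials, so the result applies equally to $\mathcal{C}_{d,n}+f'$ for any $f'$ of degree less than $d$. *)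

(* Defs.v *)
From mathcomp Require Import all_boot all_order all_algebra.
From mathcomp Require Import mpoly.

Set Implicit Arguments.
Unset Strict Implicit.
Unset Printing Implicit Defensive.

Import GRing.Theory.

Local Open Scope ring_scope.

(* {0,1}^n and {0,1} are 'rV['F_2]_n and 'F_2; n = 0 is allowed, as it is
   needed for restrictions to single points. *)
Definition boolfun (n : nat) := 'rV['F_2]_n -> 'F_2.

Definition multilinear n (p : {mpoly 'F_2[n]}) : bool :=
  all (fun m : 'X_{1..n} => [forall i, (m i <= 1)%N]) (msupp p).

Definition represents n (p : {mpoly 'F_2[n]}) (f : boolfun n) : bool :=
  multilinear p && [forall x : 'rV['F_2]_n, p.@[fun i => x 0 i] == f x].

Lemma multilinear_eq0 n (p : {mpoly 'F_2[n]}) :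
  multilinear p -> (forall x : 'rV['F_2]_n, p.@[fun i => x 0 i] = 0) -> p = 0.
Proof.
move=> /allP mlp p0; apply/eqP; apply: contraT => nzp.
have : exists k, has (fun m => mdeg m == k) (msupp p).
  by exists (mdeg (mlead p)); apply/hasP; exists (mlead p) => //; apply: mlead_supp.
move=> exk; case: (ex_minnP exk) => k /hasP[m m_p /eqP dm] mink.
have := p0 (\row_i (m i)%:R).
rewrite mevalE (bigD1_seq m) ?msupp_uniq //=.
rewrite [X in _ * X]big1 ?mulr1; last first.
  move=> i _; rewrite mxE; have /forallP/(_ i) := mlp _ m_p.
  by case: (m i) => [|[|]] // _; rewrite ?expr0 ?expr1.
rewrite big1_seq ?addr0 => [pm0|m' /andP[nm m'_p]].
  by rewrite mcoeff_msupp pm0 eqxx in m_p.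
have [i /andP[mi0 m'i1]] : exists i, (m i == 0)%N && (m' i != 0)%N.
  apply/existsP; apply: contraT => /existsPn sub.
  have le_m : forall i, (m' i <= m i)%N.
    move=> i; have := sub i; have /forallP/(_ i) := mlp _ m'_p.
    by case: (m' i) => [|[|]] //; case: (m i).
  have le_d : (mdeg m <= mdeg m')%N.
    by rewrite dm; apply: mink; apply/hasP; exists m'.
  case/negP: nm; apply/eqP/mnmP => i; apply/eqP.
  rewrite eqn_leq le_m /=; apply: contraT; rewrite -ltnNge => lt_i.
  suff : (mdeg m' < mdeg m)%N by rewrite ltnNge le_d.
  rewrite !mdegE (bigD1 i) //= [X in (_ < X)%N](bigD1 i) //= -addSn.
  by apply: leq_add => //; apply: leq_sum.
by rewrite (bigD1 i) //= mxE (eqP mi0) expr0n (negPf m'i1) mul0r mulr0.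
Qed.

Lemma represents_uniq n (f : boolfun n) (p q : {mpoly 'F_2[n]}) :
  represents p f -> represents q f -> p = q.
Proof.
move=> /andP[/allP mlp /forallP pf] /andP[/allP mlq /forallP qf].
apply/eqP; rewrite -subr_eq0; apply/eqP; apply: multilinear_eq0.
  apply/allP => m /msuppB_le; rewrite mem_cat.
  by case/orP; [apply: mlp | apply: mlq].
by move=> x; rewrite mevalB (eqP (pf x)) (eqP (qf x)) subrr.
Qed.

Lemma represents_exists n (f : boolfun n) : exists p, represents p f.
Proof.
pose P (c : {ffun {set 'I_n} -> 'F_2}) : {mpoly 'F_2[n]} :=
  \sum_(S : {set 'I_n}) c S *: 'X_[mesym1 S].
have mlP c : multilinear (P c).
  apply/allP => m /msupp_sum_le /flattenP[_ /mapP[S _ ->]].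
  move=> /msuppZ_le; rewrite msuppX inE => /eqP->.
  by apply/forallP => i; rewrite mnmE; case: (i \in S).
have cP c S : (P c)@_(mesym1 S) = c S.
  rewrite raddf_sum (bigD1 S) //= big1 ?addr0 => [|T nTS].
    by rewrite mcoeffZ mcoeffX eqxx mulr1.
  by rewrite mcoeffZ mcoeffX (inj_eq (@inj_mesym1 _)) (negPf nTS) mulr0.
pose F c := [ffun x : 'rV['F_2]_n => (P c).@[fun i => x 0 i]].
have injF : injective F.
  move=> c c' /ffunP eqF; apply/ffunP => S; rewrite -!cP.
  suff -> : P c = P c' by [].
  apply: (@represents_uniq n (fun x => (P c).@[fun i => x 0 i])).
    by rewrite /represents mlP; apply/forallP => x.
  rewrite /represents mlP; apply/forallP => x.
  by have := eqF x; rewrite !ffunE => ->.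
have eq_card : #|{ffun 'rV['F_2]_n -> 'F_2}|
             = #|{ffun {set 'I_n} -> 'F_2}|.
  rewrite !card_ffun card_mx mul1n !card_Fp //.
  by rewrite -[#|{set 'I_n}|]cardsT -powersetT card_powerset cardsT card_ord.
have /codomP[c Fc] : finfun f \in codom F by apply: inj_card_onto; rewrite ?eq_card.
exists (P c); rewrite /represents mlP; apply/forallP => x.
by move/ffunP: Fc => /(_ x); rewrite !ffunE => ->.
Qed.

Definition anf n (f : boolfun n) : {mpoly 'F_2[n]} :=
  xchoose (represents_exists f).

Lemma anfP n (f : boolfun n) : represents (anf f) f.
Proof. exact: (xchooseP (represents_exists f)). Qed.

(* [msize] is the total degree plus one, and [msize 0 = 0]; thus the zero
   function gets degree 0.  Only comparisons with degrees >= 1 matter below. *)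
Definition deg2 n (f : boolfun n) : nat := (msize (anf f)).-1.

(* The affine subspace a + V, with V the row space of the matrix [V], is
   identified with GF(2)^(dim V) through y |-> a + y *m row_base V. *)
Definition restrict n (f : boolfun n) (a : 'rV['F_2]_n) (V : 'M['F_2]_n) :
    boolfun (\rank V) :=
  fun y => f (a + y *m row_base V).
Arguments restrict {n} f a V.

(* The index n of [minn] is the codimension of a point, hence is harmless when
   [deg2 f >= 1] (see [lrank_attained]); if [deg2 f = 0] the value n is junk. *)
Definition lrank n (f : boolfun n) : nat :=
  \big[minn/n]_(H : 'rV['F_2]_n * 'M['F_2]_n
                | (deg2 (restrict f H.1 H.2) < deg2 f)%N) (n - \rank H.2)%N.

Definition sum_monomials (d n : nat) : boolfun n :=
  fun x => \sum_(I : {set 'I_n} | #|I| == d) \prod_(i in I) x 0 i.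
Arguments sum_monomials d n : clear implicits.

Lemma deg2_boolfun0 (f : boolfun 0) : deg2 f = 0%N.
Proof.
rewrite /deg2; suff : (msize (anf f) <= 1)%N by case: (msize _) => [|[]].
rewrite msizeE; apply/bigmax_leqP_seq => m _ _.
by rewrite mdegE big_ord0.
Qed.

Lemma deg2_restrict_point n (f : boolfun n) a (V : 'M['F_2]_n) :
  \rank V = 0%N -> deg2 (restrict f a V) = 0%N.
Proof.
rewrite /restrict => r0; move: (row_base V).
by rewrite r0 => B; apply: deg2_boolfun0.
Qed.

Lemma lrank_le n (f : boolfun n) (a : 'rV['F_2]_n) (V : 'M['F_2]_n) :
  (deg2 (restrict f a V) < deg2 f)%N -> (lrank f <= n - \rank V)%N.
Proof.
move=> lt; rewrite /lrank; have := mem_index_enum (a, V).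
elim: (index_enum _) => // H s IHs; rewrite inE big_cons.
case/predU1P => [<- | /IHs le_s]; first by rewrite lt geq_minl.
by case: ifP => // _; rewrite (leq_trans (geq_minr _ _)).
Qed.

Lemma lrank_attained n (f : boolfun n) : (0 < deg2 f)%N ->
  exists a, exists2 V, (deg2 (restrict f a V) < deg2 f)%N
                     & lrank f = (n - \rank V)%N.
Proof.
move=> f_gt0; rewrite /lrank.
apply: (big_ind (fun k => exists a, exists2 V,
  (deg2 (restrict f a V) < deg2 f)%N & k = (n - \rank V)%N)).
- exists 0, 0; last by rewrite mxrank0 subn0.
  by rewrite deg2_restrict_point ?mxrank0.
- by move=> x y hx hy; rewrite /minn; case: ifP.
- by move=> [a V] /= lt; exists a, V.
Qed.

Lemma deg2_sum_monomials (d n : nat) : (d <= n)%N ->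
  deg2 (sum_monomials d n) = d.
Proof.
move=> le_dn; rewrite /deg2.
have -> : anf (sum_monomials d n) = mesym n 'F_2 d.
  apply: represents_uniq (anfP _) _; apply/andP; split.
    apply/allP => m; rewrite mem_msupp_mesym mecharP => /existsP[S /andP[/eqP-> _]].
    by apply/forallP => i; rewrite mnmE; case: (i \in S).
  apply/forallP => x; rewrite /mesym raddf_sum /=; apply/eqP/eq_bigr => S _.
  by rewrite rmorph_prod; apply: eq_bigr => i _; rewrite /= mevalXU.
have [S cS] : exists S : {set 'I_n}, #|S| = d.
  exists [set widen_ord le_dn i | i : 'I_d].
  rewrite card_imset ?card_ord // => i j /(congr1 val) /= ij; exact: val_inj.
suff -> : msize (mesym n 'F_2 d) = d.+1 by [].
apply/eqP; rewrite eqn_leq; apply/andP; split.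
  rewrite msizeE; apply/bigmax_leqP_seq => m.
  rewrite mem_msupp_mesym mecharP => /existsP[T /andP[/eqP-> /eqP <-]] _.
  by rewrite mdeg_mesym1.
by rewrite -{1}cS -mdeg_mesym1; apply: msize_mdeg_lt; rewrite -cS mem_mesym1_mesym.
Qed.

(* Main.v *)
Require Import Defs.
From mathcomp Require Import all_boot all_order all_algebra.
From mathcomp Require Import mpoly zify ring.

(** A function on GF(2)^n has degree < k iff all its k-fold derivatives vanish,
a criterion that makes sense on affine subspaces without choosing coordinates.
Moreover C_d(x) = binomial(|x|, d) mod 2.

For d odd, C_d vanishes wherever |x| is even, i.e. on a hyperplane.  For d even,
imposing x_i + x_{k+i} = 1 for i < k makes |x| a function of n - 2k coordinates,
so the degree drops below d as soon as n - 2k < d.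

For the lower bound with d even, let B(v, x) = sum_{i <> j} v_i x_j be the polar
form of C_2.  The derivative of C_d in direction v is B(v, x) C_{d-2}(x) up to
degree < d - 1, so if B(v, w) = 1 then, on the B-orthogonal complement of <v, w>,
the derivative in directions v, w is C_{d-2} up to lower degree.  Iterating, C_d
keeps degree d on any direction space V such that B restricted to V has rank at
least d.  As B has rank at least 2 floor(n/2), this holds if
codim V <= floor(n/2) - d/2. *)

Set Implicit Arguments.
Unset Strict Implicit.
Unset Printing Implicit Defensive.

Import GRing.Theory.

Local Open Scope ring_scope.

(** * Arithmetic in GF(2) *)

Lemma addFF (x : 'F_2) : x + x = 0.
Proof. by apply: addrr_pchar2; apply: pchar_Fp. Qed.

Lemma addVV m n (A : 'M['F_2]_(m, n)) : A + A = 0.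
Proof. by apply/matrixP => i j; rewrite !mxE addFF. Qed.

Lemma oppF (x : 'F_2) : - x = x.
Proof. by apply/eqP; rewrite eq_sym -addr_eq0 addFF. Qed.

(** Brings characteristic 2 into [ring] proofs: with [t] given explicitly, the goal becomes an
    identity over any commutative ring. *)
Lemma eqF2 (x y t : 'F_2) : x - y = t + t -> x = y.
Proof. by rewrite addFF => /eqP; rewrite subr_eq0 => /eqP. Qed.

Lemma F2_nat (x : 'F_2) : x = (x != 0)%:R.
Proof. by case: x => [[|[|]]] // i; apply/eqP. Qed.

Lemma F2_odd (k : nat) : k%:R = (odd k)%:R :> 'F_2.
Proof.
elim: k => // k IH; rewrite -natr1 IH /=.
by case: (odd k); rewrite ?addFF ?add0r.
Qed.

(** * Iterated derivatives and the degree bounds they define *)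

Definition derv n (v : 'rV['F_2]_n) (f : boolfun n) : boolfun n :=
  fun x => f (x + v) + f x.

Definition cube n (vs : seq 'rV['F_2]_n) (f : boolfun n) : boolfun n :=
  foldr (@derv n) f vs.

(** The bound is strict so that [deg_lt 0] can single out the zero function. Directions may repeat
    or be dependent. *)
Definition deg_lt n k (f : boolfun n) : Prop :=
  forall vs x, size vs = k -> cube vs f x = 0.

Section Cube.
Variable n : nat.
Implicit Types (f g : boolfun n) (u v x : 'rV['F_2]_n) (vs : seq 'rV['F_2]_n).

Lemma cube_cat vs1 vs2 f : cube (vs1 ++ vs2) f = cube vs1 (cube vs2 f).
Proof. by rewrite /cube foldr_cat. Qed.

Lemma cube_rcons vs v f : cube (rcons vs v) f = cube vs (derv v f).
Proof. by rewrite -cats1 cube_cat. Qed.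

(** Derivatives along directions of [W] only see values on the coset a + W, so a function may be
    replaced by a simpler one agreeing with it there. *)
Lemma eq_cube_in m (W : 'M['F_2]_(m, n)) vs f g a :
    all (fun v => (v <= W)%MS) vs ->
    (forall y, (y <= W)%MS -> f (a + y) = g (a + y)) ->
  forall y, (y <= W)%MS -> cube vs f (a + y) = cube vs g (a + y).
Proof.
elim: vs => //= v vs IH /andP[vW vsW] fg y yW.
by rewrite /derv -addrA !IH // addmx_sub.
Qed.

Lemma eq_cube vs f g : f =1 g -> cube vs f =1 cube vs g.
Proof. by move=> fg; elim: vs => //= v vs IH x; rewrite /derv !IH. Qed.

Lemma cubeD vs f g : cube vs (fun x => f x + g x) =1 fun x => cube vs f x + cube vs g x.
Proof. by elim: vs => //= v vs IH x; rewrite /derv !IH addrACA. Qed.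

Lemma cube_shift vs f u : cube vs (fun x => f (x + u)) =1 fun x => cube vs f (x + u).
Proof. by elim: vs => //= v vs IH x; rewrite /derv !IH addrAC. Qed.

Lemma cube0 vs f : (forall x, f x = 0) -> forall x, cube vs f x = 0.
Proof. by move=> f0; elim: vs => //= v vs IH x; rewrite /derv !IH addr0. Qed.

Lemma cube_rconsE vs v f x : cube (rcons vs v) f x = cube vs f (x + v) + cube vs f x.
Proof. by rewrite cube_rcons /derv cubeD cube_shift. Qed.

Lemma eq_deg_lt k f g : f =1 g -> deg_lt k f -> deg_lt k g.
Proof. by move=> fg fk vs x sz; rewrite -(eq_cube vs fg) fk. Qed.

Lemma deg_ltS k f : (forall v, deg_lt k (derv v f)) -> deg_lt k.+1 f.
Proof.
move=> fk vs x; case/lastP: vs => // vs v.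
by rewrite size_rcons cube_rcons => -[/fk ->].
Qed.

Lemma deg_lt_derv k v f : deg_lt k.+1 f -> deg_lt k (derv v f).
Proof. by move=> fk vs x sz; rewrite -cube_rcons fk // size_rcons sz. Qed.

Lemma deg_lt_leq k l f : (k <= l)%N -> deg_lt k f -> deg_lt l f.
Proof.
move=> /subnKC <- fk; elim: (l - k)%N => [|j IH]; first by rewrite addn0.
rewrite addnS => -[|v vs] x //= [sz].
by rewrite /derv !IH // addr0.
Qed.

Lemma deg_ltD k f g : deg_lt k f -> deg_lt k g -> deg_lt k (fun x => f x + g x).
Proof. by move=> fk gk vs x sz; rewrite cubeD fk // gk // addr0. Qed.

Lemma deg_lt_shift k f u : deg_lt k f -> deg_lt k (fun x => f (x + u)).
Proof. by move=> fk vs x sz; rewrite cube_shift fk. Qed.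

Lemma deg_lt0 k f : (forall x, f x = 0) -> deg_lt k f.
Proof. by move=> f0 vs x _; apply: cube0. Qed.

Lemma deg_lt_0P f : deg_lt 0 f -> f =1 fun=> 0.
Proof. by move=> f0 x; apply: (f0 [::]). Qed.

(** Induction on k + l through the Leibniz rule D_v(fg)(x) = f(x + v) D_v g(x) + D_v f(x) g(x). If k
    or l is 0, the product is zero. *)
Lemma deg_ltM k l f g :
  deg_lt k f -> deg_lt l g -> deg_lt (k + l).-1 (fun x => f x * g x).
Proof.
move: {2}(k + l)%N (leqnn (k + l)) => N.
elim: N k l f g => [|N IH] [|k] [|l] f g leN fk gl //;
  try by apply: deg_lt0 => x; rewrite (deg_lt_0P fk) mul0r.
  by apply: deg_lt0 => x; rewrite (deg_lt_0P gl) mulr0.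
rewrite addSn /= addnS; apply: deg_ltS => v.
apply: (@eq_deg_lt _ (fun x => f (x + v) * derv v g x + derv v f x * g x)).
  move=> x; rewrite /derv mulrDr mulrDl -addrA; congr (_ + _).
  by rewrite addrA addFF add0r.
apply: deg_ltD.
  apply: (IH k.+1 l); first lia.
    exact: deg_lt_shift.
  exact: deg_lt_derv.
rewrite -[(k + l)%N]/(k + l).+1.-1 -addnS.
apply: IH; [lia | exact: deg_lt_derv | by []].
Qed.

Lemma deg_lt_const c : deg_lt 1 (fun _ : 'rV_n => c).
Proof. by apply: deg_ltS => v; apply: deg_lt0 => x; rewrite /derv addFF. Qed.

Lemma deg_lt_coord i : deg_lt 2 (fun x : 'rV['F_2]_n => x 0 i).
Proof.
apply: deg_ltS => v; apply: (@eq_deg_lt _ (fun _ => v 0 i)); last exact: deg_lt_const.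
by move=> x; rewrite /derv mxE addrAC addFF add0r.
Qed.

Lemma deg_lt_sum (I : Type) (r : seq I) (P : pred I) (F : I -> boolfun n) k :
  (forall i, P i -> deg_lt k (F i)) -> deg_lt k (fun x => \sum_(i <- r | P i) F i x).
Proof.
move=> Fk; elim: r => [|i r IH].
  by apply: deg_lt0 => x; rewrite big_nil.
apply: (@eq_deg_lt _ (fun x => (if P i then F i x else 0) + \sum_(i <- r | P i) F i x)).
  by move=> x; rewrite big_cons; case: ifP; rewrite ?add0r.
by apply: deg_ltD => //; case Pi: (P i); [apply: Fk | apply: deg_lt0].
Qed.

Lemma deg_lt_prod (I : Type) (r : seq I) (P : pred I) (F : I -> boolfun n) (e : I -> nat) :
    (forall i, P i -> deg_lt (e i).+1 (F i)) ->
  deg_lt (\sum_(i <- r | P i) e i)%N.+1 (fun x => \prod_(i <- r | P i) F i x).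
Proof.
move=> Fk; elim: r => [|i r IH].
  rewrite big_nil; apply: (@eq_deg_lt _ (fun=> 1)); last exact: deg_lt_const.
  by move=> x; rewrite big_nil.
rewrite big_cons; case: ifP => Pi; last first.
  by apply: eq_deg_lt IH => x; rewrite big_cons Pi.
apply: (@eq_deg_lt _ (fun x => F i x * \prod_(i <- r | P i) F i x)).
  by move=> x; rewrite big_cons Pi.
by have := deg_ltM (Fk _ Pi) IH; rewrite addSn addnS.
Qed.

Lemma deg_lt_exp f k : deg_lt 2 f -> deg_lt k.+1 (fun x => f x ^+ k).
Proof.
move=> f2; elim: k => [|k IH]; first exact: deg_lt_const.
by apply: eq_deg_lt (deg_ltM f2 IH) => x; rewrite exprS.
Qed.

(** * Polynomial degree versus vanishing of derivatives *)

Lemma represents_deg_lt (p : {mpoly 'F_2[n]}) f :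
  represents p f -> deg_lt (msize p) f.
Proof.
move=> /andP[_ /forallP pf].
(* The guard keeps the information that m lies in the support, which bounds its degree after
   [deg_lt_sum]. *)
apply: (@eq_deg_lt _ (fun x => \sum_(m <- msupp p) if m \in msupp p then p@_m * \prod_i x 0 i ^+ m i else 0)).
  by move=> x; rewrite -(eqP (pf x)) mevalE big_seq [RHS]big_seq; apply: eq_bigr => m ->.
apply: deg_lt_sum => m _; case mp: (m \in msupp p); last exact: deg_lt0.
have lt_m : ((mdeg m).+1 <= msize p)%N by apply: msize_mdeg_lt.
apply: deg_lt_leq lt_m _; rewrite mdegE.
rewrite -[X in deg_lt X]/(1 + _).-1; apply: deg_ltM; first exact: deg_lt_const.
apply: deg_lt_prod => i _; apply: deg_lt_exp; exact: deg_lt_coord.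
Qed.

(** Deriving a monomial along the j-th basis vector deletes x_j if it occurs and gives 0
    otherwise. *)
Lemma cube_monomial (s : seq 'I_n) (A : {set 'I_n}) x : uniq s ->
  cube [seq delta_mx 0 i | i <- s] (fun y => \prod_(i in A) y 0 i) x
  = if all (mem A) s then \prod_(i in A | i \notin s) x 0 i else 0.
Proof.
elim: s x => [|j s IH] x /=; first by under [RHS]eq_bigl do rewrite andbT.
case/andP=> js us; rewrite /derv !IH //.
case: (all (mem A) s); last by rewrite andbF addr0.
rewrite andbT; case: ifP => jA.
  rewrite (bigD1 j) ?jA //= [X in _ + X](bigD1 j) ?jA //= !mxE !eqxx.
  under eq_bigr => i /andP[_ /negPf ij] do rewrite !mxE ij andbF addr0.
  rewrite -mulrDl addrAC addFF add0r mul1r; apply: eq_bigl => i.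
  by rewrite inE negb_or -andbA; congr (_ && _); rewrite andbC.
rewrite [X in X + _](eq_bigr (fun i => x 0 i)) ?addFF // => i /andP[iA _].
by rewrite !mxE andbC; case: eqP iA jA => [->|_ _ _]; rewrite ?addr0 //= => ->.
Qed.

End Cube.

(** For the converse, derive f at 0 along the variables of its leading monomial. That monomial
    contributes 1; any other has no larger degree, so it misses one of these variables and
    contributes 0. *)
Lemma deg2_ltP n (f : boolfun n) k : (0 < k)%N -> (deg2 f < k)%N <-> deg_lt k f.
Proof.
move=> k_gt0; split => [lt_k|fk].
  apply: deg_lt_leq (represents_deg_lt (anfP f)).
  by move: lt_k; rewrite /deg2; lia.
rewrite ltnNge; apply/negP => le_k.
have /andP[/allP mlp /forallP pf] := anfP f; set p := anf f in mlp pf.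
have nzp : p != 0 by apply: contraTneq le_k; rewrite /deg2 -/p => ->; rewrite msize0 -ltnNge.
pose m := mlead p; pose s := [seq i <- enum 'I_n | m i != 0%N].
have mp : m \in msupp p by apply: mlead_supp.
have us : uniq s by rewrite filter_uniq ?enum_uniq.
have sz : size s = deg2 f.
  rewrite /deg2 -/p -(mlead_deg nzp) /= mdegE size_filter -sum1_count big_enum_cond /=.
  rewrite big_mkcond; apply: eq_bigr => i _.
  by have /forallP/(_ i) := mlp _ mp; rewrite -/m; case: (m i) => [|[|]].
have fd : deg_lt (deg2 f) f by apply: deg_lt_leq le_k fk.
have /eqP : cube [seq delta_mx 0 i | i <- s] f 0 = 0 by apply: fd; rewrite size_map.
apply/negP.
pose A (m' : 'X_{1..n}) := [set i | m' i != 0%N].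
rewrite (@eq_cube _ _ _ (fun x => \sum_(m' <- msupp p) \prod_(i in A m') x 0 i)); last first.
  move=> x; rewrite -(eqP (pf x)) mevalE; apply: eq_big_seq => m' m'p.
  have -> : p@_m' = 1 by rewrite [LHS]F2_nat -mcoeff_msupp m'p.
  rewrite mul1r [RHS]big_mkcond; apply: eq_bigr => i _; rewrite inE.
  by have /forallP/(_ i) := mlp _ m'p; case: (m' i) => [|[|]].
have cube_sum vs (r : seq 'X_{1..n}) (F : 'X_{1..n} -> boolfun n) x :
    cube vs (fun x => \sum_(m' <- r) F m' x) x = \sum_(m' <- r) cube vs (F m') x.
  elim: r => [|m' r IH]; first by rewrite big_nil cube0 // => y; rewrite big_nil.
  rewrite big_cons -IH -cubeD; apply: eq_cube => y; exact: big_cons.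
rewrite cube_sum (bigD1_seq m) ?msupp_uniq //= cube_monomial //.
rewrite [X in _ + X]big1_seq ?addr0 => [|m' /andP[nm m'p]]; last first.
  rewrite /= cube_monomial //; case: ifP => // /allP sub; case/negP: nm.
  have le_m i : (m i <= m' i)%N.
    have /forallP/(_ i) := mlp _ mp; rewrite -/m.
    have : i \in s -> m' i != 0%N by move=> /sub; rewrite /= inE.
    by rewrite mem_filter mem_enum andbT; case: (m i) (m' i) => [|[|]] //= [|] // ->.
  have le_d : (mdeg m' <= mdeg m)%N.
    by rewrite -ltnS mlead_deg //; apply: msize_mdeg_lt.
  have dm' : (m' - m + m)%MM = m' by apply: submK; apply/mnm_lepP.
  have : mdeg (m' - m)%MM == 0%N by move: le_d; rewrite -{1}dm' mdegD; lia.
  by rewrite mdeg_eq0 => /eqP m0; rewrite -dm' m0 add0m.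
rewrite (_ : all _ _); last first.
  by apply/allP => i; rewrite mem_filter /= inE => /andP[].
rewrite big1 ?oner_eq0 // => i; rewrite inE mem_filter mem_enum => /andP[->]//.
Qed.

Lemma cube_restrict n (f : boolfun n) a (V : 'M['F_2]_n) ws y :
  cube ws (restrict f a V) y
  = cube [seq w *m row_base V | w <- ws] f (a + y *m row_base V).
Proof. by elim: ws y => //= w ws IH y; rewrite /derv !IH mulmxDl addrA. Qed.

(** Coordinate directions w correspond to directions of [V] through [row_base V]; [pinvmx] recovers
    the coordinates of a vector of [V]. *)
Lemma deg2_restrict_ltP n (f : boolfun n) a (V : 'M['F_2]_n) k : (0 < k)%N ->
  (deg2 (restrict f a V) < k)%N <->
  (forall vs y, all (fun v => (v <= V)%MS) vs -> (y <= V)%MS -> size vs = k ->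
    cube vs f (a + y) = 0).
Proof.
move=> /(deg2_ltP (restrict f a V)) ->; split=> [fk vs y vsV yV sz | fk ws y sz].
  have pK v : (v <= V)%MS -> v *m pinvmx (row_base V) *m row_base V = v.
    by move=> vV; apply: mulmxKpV; rewrite eq_row_base.
  have <- : [seq w *m row_base V | w <- [seq v *m pinvmx (row_base V) | v <- vs]] = vs.
    by rewrite -map_comp -[RHS]map_id; apply/eq_in_map => v /(allP vsV)/pK.
  rewrite -(pK _ y yV) -cube_restrict fk // size_map //.
have sV m (z : 'M_(m, _)) : (z *m row_base V <= V)%MS.
  by rewrite (submx_trans (submxMl _ _)) ?eq_row_base.
rewrite cube_restrict fk ?size_map //.
by apply/allP => v /mapP[w _ ->].
Qed.

Lemma deg2_restrict_full n (f : boolfun n) a (V : 'M['F_2]_n) k :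
  (0 < k)%N -> \rank V = n -> (deg2 (restrict f a V) < k)%N -> (deg2 f < k)%N.
Proof.
move=> k_gt0 rV /(deg2_restrict_ltP _ _ _ k_gt0) fk; apply/deg2_ltP => // vs x sz.
have fullV v : (v <= V)%MS by apply: submx_full; rewrite /row_full rV.
by rewrite -(subrK a x) addrC fk //; apply/allP.
Qed.

(** * Binomial form of C_d, the case d odd, and positivity of the rank *)

Definition wt n (x : 'rV['F_2]_n) : nat := (\sum_i (x 0%R i != 0%R))%N.

Lemma sum_monomials_wt d n (x : 'rV['F_2]_n) :
  sum_monomials d n x = 'C(wt x, d)%:R.
Proof.
pose S := [set i | x 0 i != 0].
have -> : wt x = #|S|.
  by rewrite /wt -sum1_card [RHS]big_mkcond; apply: eq_bigr => i _; rewrite inE; case: ifP.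
rewrite -cards_draws -sum1_card natr_sum /sum_monomials [LHS]big_mkcond [RHS]big_mkcond.
apply: eq_bigr => I _; rewrite inE andbC; case: eqP => //= _.
case: (boolP (I \subset S)) => [/subsetP sIS|/subsetPn[i iI]].
  by apply: big1 => i /sIS; rewrite inE [RHS]F2_nat [LHS]F2_nat => ->.
by rewrite inE negbK => /eqP xi; rewrite (bigD1 i) //= xi mul0r.
Qed.

Lemma wt_natr n (x : 'rV['F_2]_n) : (wt x)%:R = \sum_i x 0 i :> 'F_2.
Proof. by rewrite natr_sum; apply: eq_bigr => i _; rewrite -F2_nat. Qed.

Lemma deg_lt_sum_monomials d n : deg_lt d.+1 (sum_monomials d n).
Proof.
apply: deg_lt_sum => I /eqP <-; rewrite -sum1_card.
by apply: deg_lt_prod => i _; apply: deg_lt_coord.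
Qed.

(** Reduce k C(m, k) = m C(m - 1, k - 1) mod 2. *)
Lemma bin_even_odd m k : odd k -> ~~ odd m -> ~~ odd 'C(m, k).
Proof.
case: k => // k ok em; have := mul_bin_diag m k.
case: m em => [|m] em; first by rewrite bin0n.
move=> /(congr1 odd); rewrite !oddM /= -/(odd k.+1) ok.
move: em => /= /negPf ->.
by rewrite /= => <-.
Qed.

Lemma boolfun_deg_lt n (f : boolfun n) : deg_lt n.+1 f.
Proof.
have fr := represents_deg_lt (anfP f); apply: deg_lt_leq fr.
have /andP[/allP ml _] := anfP f.
rewrite msizeE; apply/bigmax_leqP_seq => m mp _; rewrite ltnS mdegE.
rewrite -[X in (_ <= X)%N]card_ord -sum1_card; apply: leq_sum => i _.
by have /forallP := ml _ mp.
Qed.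

Lemma lrank_le_odd d n : odd d -> (d <= n)%N -> (lrank (sum_monomials d n) <= 1)%N.
Proof.
move=> od dn; have d_gt0 : (0 < d)%N by case: d od {dn}.
pose J : 'cV['F_2]_n := const_mx 1.
apply: leq_trans (@lrank_le _ _ 0 (kermx J) _) _.
  rewrite deg2_sum_monomials //; apply/deg2_ltP => //; apply: deg_lt0 => x.
  rewrite /restrict add0r sum_monomials_wt; set y := _ *m _.
  have yJ : y *m J = 0.
    by apply/sub_kermxP; rewrite (submx_trans (submxMl _ _)) ?eq_row_base.
  have wy : (wt y)%:R = 0 :> 'F_2.
    transitivity ((y *m J) 0 0); last by rewrite yJ mxE.
    by rewrite wt_natr mxE; apply: eq_bigr => i _; rewrite [J _ _]mxE mulr1.
  rewrite F2_odd (negPf (bin_even_odd od _)) //.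
  by move: wy; rewrite F2_odd; case: (odd _).
by rewrite mxrank_ker; have := rank_leq_col J; lia.
Qed.

Lemma lrank_gt0 d n : (0 < d <= n)%N -> (0 < lrank (sum_monomials d n))%N.
Proof.
case/andP => d_gt0 dn; have dE := deg2_sum_monomials dn.
have [|a [V ltd ->]] := @lrank_attained _ (sum_monomials d n); first by rewrite dE.
rewrite lt0n subn_eq0 -ltnNge ltn_neqAle rank_leq_row andbT.
apply/negP => /eqP rV; rewrite dE in ltd.
by have := deg2_restrict_full d_gt0 rV ltd; rewrite dE ltnn.
Qed.

(** * Upper bound for d even *)

Lemma wt_row_mx m n (x : 'rV['F_2]_m) (y : 'rV['F_2]_n) :
  wt (row_mx x y) = (wt x + wt y)%N.
Proof.
rewrite /wt big_split_ord; congr (_ + _)%N; apply: eq_bigr => i _.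
  by rewrite row_mxEl.
by rewrite row_mxEr.
Qed.

Lemma wt_compl k (u : 'rV['F_2]_k) : (wt (const_mx 1 + u)%R + wt u = k)%N.
Proof.
rewrite /wt -big_split /= -[RHS]card_ord -sum1_card; apply: eq_bigr => i _.
by rewrite !mxE [u 0 i]F2_nat; case: (u 0 i != 0).
Qed.

Lemma lrank_le_pairs d k m : (m < d <= k + (k + m))%N ->
  (lrank (sum_monomials d (k + (k + m))) <= k)%N.
Proof.
case/andP => lt_md dn.
pose A : 'M['F_2]_(k + (k + m), k) := col_mx 1%:M (col_mx 1%:M 0).
(* On a + kermx A, coordinates i and k + i are complementary for i < k, so the
   weight, hence the function, depends only on the last m coordinates. *)
pose a : 'rV['F_2]_(k + (k + m)) := row_mx (const_mx 1) 0.
apply: leq_trans (@lrank_le _ _ a (kermx A) _) _; last first.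
  by rewrite mxrank_ker; have := rank_leq_col A; lia.
rewrite deg2_sum_monomials //; apply/deg2_restrict_ltP; first by lia.
move=> vs y vsA yA sz.
pose h (x : 'rV['F_2]_(k + (k + m))) := rsubmx (rsubmx x).
pose g : boolfun m := fun z => 'C(k + wt z, d)%:R.
rewrite (eq_cube_in (g := g \o h) vsA) // => [|{yA}y /sub_kermxP].
  have cg x : cube vs (g \o h) x = cube [seq h v | v <- vs] g (h x).
    by elim: vs x {vsA sz} => //= v vs IH x; rewrite /derv !IH /h !linearD.
  (* A function of m < d variables has degree at most m, hence less than d. *)
  rewrite cg; apply: (deg_lt_leq lt_md (boolfun_deg_lt g)).
  by rewrite size_map.
rewrite -[y]hsubmxK -[rsubmx y]hsubmxK /A !mul_row_col mulmx0 !mulmx1 addr0.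
set u := lsubmx y; set v := lsubmx _; set z := rsubmx _ => /eqP.
rewrite addr_eq0 => /eqP uv.
rewrite sum_monomials_wt /g /= /h /a -[0]hsubmxK !add_row_mx !row_mxKr !wt_row_mx.
rewrite !linear0 !add0r addnA uv (_ : - v = v) ?wt_compl //.
by apply/eqP; rewrite eq_sym -addr_eq0 addVV.
Qed.

(** * The polar form and the derivatives of C_d *)

Definition polar_mx n : 'M['F_2]_n := const_mx 1 - 1%:M.

Definition polar n (v x : 'rV['F_2]_n) : 'F_2 := (v *m polar_mx n *m x^T) 0 0.

Lemma polarDl n (v w x : 'rV['F_2]_n) : polar (v + w) x = polar v x + polar w x.
Proof. by rewrite /polar !mulmxDl mxE. Qed.

Lemma polarDr n (v x y : 'rV['F_2]_n) : polar v (x + y) = polar v x + polar v y.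
Proof. by rewrite /polar [(x + y)^T]linearD mulmxDr mxE. Qed.

Lemma polarE n (v x : 'rV['F_2]_n) :
  polar v x = (\sum_i v 0 i) * (\sum_i x 0 i) - \sum_i v 0 i * x 0 i.
Proof.
rewrite /polar /polar_mx mulmxBr mulmxBl mulmx1 mxE [X in _ + X]mxE; congr (_ - _).
  rewrite mxE mulr_sumr; apply: eq_bigr => j _; rewrite !mxE; congr (_ * _).
  by apply: eq_bigr => i _; rewrite mxE mulr1.
by rewrite mxE; apply: eq_bigr => i _; rewrite mxE.
Qed.

Lemma polarxx n (v : 'rV['F_2]_n) : polar v v = 0.
Proof.
have sq (x : 'F_2) : x * x = x by case: x => [[|[|]]] // i; apply/eqP.
rewrite polarE sq [X in _ - X](eq_bigr (fun i => v 0 i)) ?subrr // => i _; exact: sq.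
Qed.

Lemma polarC n (v w : 'rV['F_2]_n) : polar v w = polar w v.
Proof. by rewrite !polarE mulrC; congr (_ - _); apply: eq_bigr => i _; rewrite mulrC. Qed.

Lemma bin_recF2 w h : ~~ odd h -> 'C(w, h.+1)%:R = w%:R * 'C(w, h)%:R :> 'F_2.
Proof.
move=> eh; have := congr1 (fun k => k%:R : 'F_2) (mul_bin_left w h).
rewrite !natrM F2_odd /= eh mul1r => ->.
case: (leqP h w) => [hw|wh]; last by rewrite bin_small // !mulr0.
by rewrite natrB // [h%:R]F2_odd (negPf eh) subr0.
Qed.

(* Both sides depend only on x_i and on the weight w of the other coordinates,
   which turns the identity into one between binomial coefficients mod 2. *)
Lemma derv_delta_sum_monomials n h (i : 'I_n) x : ~~ odd h ->
  derv (delta_mx 0 i) (sum_monomials h.+2 n) x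
  = polar (delta_mx 0 i) x * sum_monomials h n x
    + x 0 i * derv (delta_mx 0 i) (sum_monomials h n) x.
Proof.
move=> eh; pose w := (\sum_(j < n | j != i) (x 0%R j != 0%R))%N.
have wx : wt x = ((x 0%R i != 0%R) + w)%N by rewrite /wt (bigD1 i).
have wxi : wt (x + delta_mx 0 i) = ((x 0%R i == 0%R) + w)%N.
  rewrite /wt (bigD1 i) //= !mxE !eqxx; congr (_ + _)%N.
    by rewrite [x 0 i]F2_nat; case: (x 0 i != 0).
  by apply: eq_bigr => j /negPf ji; rewrite !mxE ji andbF addr0.
have -> : polar (delta_mx 0 i) x = w%:R.
  have dE j : (delta_mx 0 i : 'rV['F_2]_n) 0 j = (j == i)%:R by rewrite mxE eqxx.
  rewrite polarE (bigD1 i) //= big1 => [|j /negPf ji]; last by rewrite dE ji.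
  rewrite [X in _ - X](bigD1 i) //= [X in _ - (_ + X)]big1 => [|j /negPf ji]; last first.
    by rewrite dE ji mul0r.
  rewrite dE eqxx addr0 !mul1r addr0 (bigD1 i) //= addrAC subrr add0r natr_sum.
  by apply: eq_bigr => j _; exact: F2_nat.
have bS k m : 'C(k.+1, m.+1)%:R = 'C(k, m.+1)%:R + 'C(k, m)%:R :> 'F_2.
  by rewrite binS natrD.
rewrite /derv !sum_monomials_wt wx wxi [x 0 i]F2_nat; case: (x 0 i == 0) => /=.
  by rewrite !add1n !add0n mul0r addr0 bS addrAC addFF add0r bin_recF2.
rewrite !add1n !add0n mul1r bS addrA addFF add0r.
have := bin_recF2 w.+1 eh; rewrite bS -natr1 mulrDl mul1r => e1.
rewrite addrCA -e1 addrCA addFF addr0 //.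
Qed.

(** The claim is additive in v: D_{u+w} differs from D_u + D_w by D_u D_w, which takes C_{h+2} to
    degree at most h. It remains to treat basis vectors, where the error x_i D_{e_i} C_h also has
    degree at most h. *)
Lemma derv_sum_monomials n h (v : 'rV['F_2]_n) : ~~ odd h ->
  deg_lt h.+1 (fun x => derv v (sum_monomials h.+2 n) x
                        + polar v x * sum_monomials h n x).
Proof.
move=> eh; pose P u := deg_lt h.+1 (fun x => derv u (sum_monomials h.+2 n) x
                        + polar u x * sum_monomials h n x).
rewrite -/(P v) (row_sum_delta v); apply: (big_ind P) => [|u w Pu Pw|i _].
- apply: deg_lt0 => x; rewrite /derv addr0 addFF add0r /polar !mul0mx mxE.
  by rewrite mul0r.
- pose g := derv u (derv w (sum_monomials h.+2 n)).
  have dg : deg_lt h.+1 g by do 2!apply: deg_lt_derv; apply: deg_lt_sum_monomials.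
  apply: eq_deg_lt (deg_ltD (deg_ltD Pu Pw) dg) => x.
  rewrite /g /derv polarDl [x + (u + w)]addrA.
  set f := sum_monomials _ n; set e := sum_monomials _ n x.
  apply: (eqF2 (t := f x + f (x + w) + f (x + u))); ring.
rewrite [v 0 i]F2_nat; case: (v 0 i != 0); last first.
  rewrite scale0r; apply: deg_lt0 => x; rewrite /derv addr0 addFF add0r /polar !mul0mx mxE.
  by rewrite mul0r.
rewrite scale1r.
have dm : deg_lt h.+1 (fun x => x 0 i * derv (delta_mx 0 i) (sum_monomials h n) x).
  apply: (@deg_ltM _ 2 h); first exact: deg_lt_coord.
  by apply: deg_lt_derv; apply: deg_lt_sum_monomials.
by apply: eq_deg_lt dm => x; rewrite derv_delta_sum_monomials // addrAC addFF add0r.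
Qed.

(** Write D_v C_{h+2} = B(v, x) C_h + r with deg r <= h. The h derivatives along [vs] kill D_w r.
    Where B(v, x) = 0, the derivative of B(v, x) C_h along w is C_h(x + w), and the shift by w is
    invisible to h derivatives since deg C_h <= h. *)
Lemma cube_hyperbolic n h (v w : 'rV['F_2]_n) vs : ~~ odd h -> size vs = h ->
    polar v w = 1 -> all (fun u => polar v u == 0) vs ->
  cube (vs ++ [:: w; v]) (sum_monomials h.+2 n) 0 = cube vs (sum_monomials h n) 0.
Proof.
move=> eh sz vw1 vsv; set e := sum_monomials h n.
pose W := kermx (v *m polar_mx n)^T.
have WP u : (u <= W)%MS = (polar v u == 0).
  apply/sub_kermxP/eqP => [uW|vu0].
    by rewrite /polar -[v *m _]trmxK -trmx_mul uW !mxE.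
  apply/trmx_inj; rewrite trmx_mul trmxK trmx0; apply/matrixP => i j.
  by rewrite !ord1 [RHS]mxE.
set r := fun x => derv v (sum_monomials h.+2 n) x + polar v x * e x.
have dr : deg_lt h.+1 r by apply: derv_sum_monomials.
rewrite cube_cat /=.
rewrite (@eq_cube _ _ _ (fun x => (polar v (x + w) * e (x + w) + polar v x * e x) + derv w r x)).
  rewrite cubeD [X in _ + X](deg_lt_derv w dr) // addr0 -[0 in LHS]addr0.
  have vsW : all (fun u => (u <= W)%MS) vs by rewrite (eq_all WP).
  rewrite (eq_cube_in (g := fun x => e (x + w)) vsW) ?sub0mx // => [|y].
    rewrite addr0 cube_shift; apply/eqP; rewrite -subr_eq0 oppF -cube_rconsE.
    by rewrite deg_lt_sum_monomials // size_rcons sz.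
  by rewrite WP add0r polarDr vw1 => /eqP ->; rewrite add0r mul1r mul0r addr0.
move=> x; rewrite /r /derv.
by apply: (eqF2 (t := - (polar v (x + w) * e (x + w) + polar v x * e x))); ring.
Qed.

(** * Nonvanishing derivatives and the lower bound for d even *)

Lemma exists_cube n d k (V : 'M['F_2]_(k, n)) : ~~ odd d ->
    (d <= \rank (V *m polar_mx n *m V^T))%N ->
  exists vs, [/\ all (fun v => (v <= V)%MS) vs, size vs = d
               & cube vs (sum_monomials d n) 0 = 1].
Proof.
move=> ed; rewrite -[d]even_halfK // => {ed}; elim: d./2 V => [|h IH] V.
  by exists [::]; split=> //; rewrite /= sum_monomials_wt bin0.
rewrite doubleS; set G := _ *m V^T => leG.
have /matrix0Pn[i [j Gij]] : G != 0 by rewrite -mxrank_eq0; lia.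
pose v := row i V; pose w := row j V.
have vV : (v <= V)%MS by apply: row_sub.
have wV : (w <= V)%MS by apply: row_sub.
have vw1 : polar v w = 1.
  rewrite [LHS]F2_nat (_ : polar v w = G i j) ?Gij //.
  rewrite /polar /v -row_mul [LHS]mxE [RHS]mxE.
  by apply: eq_bigr => l _; rewrite [row _ _ _ _]mxE [w^T _ _]mxE [V^T _ _]mxE [w _ _]mxE.
have wv1 : polar w v = 1 by rewrite polarC.
pose B := polar_mx n.
(* The rows of V projected to the orthogonal complement of <v, w>. *)
pose V' := V + (V *m B *m w^T *m v + V *m B *m v^T *m w).
have V'V : (V' <= V)%MS by rewrite !addmx_sub ?mulmx_sub.
have outerP (A : 'cV_k) (u u' : 'rV_n) : A *m u *m B *m u'^T = A *m (polar u u')%:M.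
  by rewrite -!mulmxA; congr (_ *m _); rewrite mulmxA; apply: mx11_scalar.
have V'v : V' *m B *m v^T = 0.
  rewrite /V' !mulmxDl !outerP polarxx wv1 -scalemx1 scale0r mulmx0 add0r mulmx1.
  exact: addVV.
have V'w : V' *m B *m w^T = 0.
  rewrite /V' !mulmxDl !outerP polarxx vw1 -[0%:M]scalemx1 scale0r mulmx0 addr0 mulmx1.
  exact: addVV.
have [|vs [vsV' sz cvs]] := IH V'.
  (* The Gram matrices of [V] and [V'] differ by two outer products, so the rank drops by at most 2,
     matching the drop of the degree. *)
  have GE : G = V' *m B *m V'^T
      + (V *m B *m w^T *m (v *m B *m V^T) + V *m B *m v^T *m (w *m B *m V^T)).
    have -> : V' *m B *m V'^T = V' *m B *m V^T.
      have trD (X Y : 'M['F_2]_(k, n)) : (X + Y)^T = X^T + Y^T by rewrite linearD.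
      have V'T : V'^T = V^T + (v^T *m (V *m B *m w^T)^T + w^T *m (V *m B *m v^T)^T).
        by rewrite /V' !trD -!trmx_mul.
      by rewrite V'T 2!(mulmxDr (V' *m B)) !mulmxA V'v V'w !mul0mx !addr0.
    by rewrite /V' !mulmxDl !mulmxA -addrA addVV addr0.
  have rO (A : 'cV['F_2]_k) (C : 'rV_k) : (\rank (A *m C) <= 1)%N.
    by rewrite (leq_trans (mxrankM_maxl _ _)) ?rank_leq_col.
  rewrite -(leq_add2r 2) addn2 (leq_trans leG) // GE (leq_trans (mxrank_add _ _)) //.
  by rewrite leq_add2l (leq_trans (mxrank_add _ _)) // (leq_add (rO _ _) (rO _ _)).
exists (vs ++ [:: w; v]); split.
- rewrite all_cat /= vV wV !andbT; apply: sub_all vsV' => u uV'.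
  exact: submx_trans V'V.
- by rewrite size_cat sz addn2.
rewrite cube_hyperbolic ?odd_double // ; apply: sub_all vsV' => u /submxP[c ->].
rewrite polarC /polar -!mulmxA (mulmxA V') V'v mulmx0 mxE //.
Qed.

(** Let J be the all-ones matrix. As J has rank at most 1, J - I has rank at least n - 1, enough for
    n odd. For n even, J^2 = nJ = 0, so (J - I)^2 = I and J - I is invertible. *)
Lemma rank_polar_mx n : (n./2.*2 <= \rank (polar_mx n))%N.
Proof.
have := mxrank_add (const_mx 1 : 'M['F_2]_n) (polar_mx n).
have -> : const_mx 1 + polar_mx n = 1%:M.
  by rewrite /polar_mx addrA addVV sub0r; apply/eqP; rewrite eq_sym -addr_eq0 addVV.
have r1 : (\rank (const_mx 1%R : 'M['F_2]_n) <= 1)%N.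
  have -> : const_mx 1 = (const_mx 1 : 'cV['F_2]_n) *m (const_mx 1 : 'rV_n).
    by apply/matrixP => i j; rewrite !mxE big_ord1 !mxE mulr1.
  by rewrite (leq_trans (mxrankM_maxl _ _)) ?rank_leq_col.
rewrite mxrank1; case: (boolP (odd n)) => [on|en].
  by have := odd_double_half n; rewrite on; lia.
move=> _; have := @mxrankM_maxl _ _ _ _ (polar_mx n) (polar_mx n).
suff -> : polar_mx n *m polar_mx n = 1%:M by rewrite mxrank1 even_halfK.
have JJ : (const_mx 1 : 'M_n) *m (const_mx 1 : 'M_n) = 0 :> 'M['F_2]_n.
  apply/matrixP => i j; rewrite !mxE (eq_bigr (fun=> 1)).
    by rewrite sumr_const card_ord F2_odd (negPf en).
  by move=> l _; rewrite !mxE mulr1.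
rewrite /polar_mx mulmxBr !mulmxBl JJ !mul1mx !mulmx1 sub0r opprB addrCA.
by rewrite -opprD addVV oppr0 addr0.
Qed.

Lemma lrank_ge_even d n : ~~ odd d -> (0 < d <= n)%N ->
  (n./2 - d./2 < lrank (sum_monomials d n))%N.
Proof.
move=> ed /andP[d_gt0 dn]; have dE := deg2_sum_monomials dn.
have [|a [V ltd ->]] := @lrank_attained _ (sum_monomials d n); first by rewrite dE.
rewrite ltnNge; apply/negP => le_cod; rewrite dE in ltd.
have fd := (deg2_restrict_ltP _ _ _ d_gt0).1 ltd.
have [|vs [vsV sz cvs]] := @exists_cube n d _ V ed.
  (* Sylvester's rank inequality, used twice, gives rank (V B V^T) >= rank B - 2 codim V >= d. *)
  have arith r b c e : (n - r <= n./2 - d./2 -> n./2.*2 <= b -> r <= n ->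
    r + b - n <= c -> c + r - n <= e -> d <= e)%N by have := even_halfK ed; lia.
  apply: arith le_cod (rank_polar_mx n) (rank_leq_row V) (mxrank_mul_min _ _) _.
  by rewrite -(mxrank_tr V) mxrank_mul_min.
(* The d-fold derivatives of C_d are constant, so the value 1 at 0 contradicts the value 0 at a. *)
have : cube (rcons vs a) (sum_monomials d n) 0 = 0.
  by rewrite deg_lt_sum_monomials // size_rcons sz.
rewrite cube_rconsE cvs add0r -[a]addr0 fd ?sub0mx // add0r => /eqP.
Qed.

Theorem theorem3p1 (n d : nat) (hd : (1 <= d)%N) (hdn : (d <= n)%N) :
  (odd d -> lrank (sum_monomials d n) = 1%N) /\
  (~~ odd d ->
     [/\ lrank (sum_monomials d n) = (n %/ 2 - d %/ 2 + 1)%N,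
         ~~ odd n -> lrank (sum_monomials d n) = ((n - d) %/ 2 + 1)%N
       & odd n -> lrank (sum_monomials d n) = ((n - d - 1) %/ 2 + 1)%N]).
Proof.
have dn : (0 < d <= n)%N by rewrite hd.
split=> [od|ed].
  by apply/eqP; rewrite eqn_leq lrank_le_odd ?lrank_gt0.
have main : lrank (sum_monomials d n) = (n %/ 2 - d %/ 2 + 1)%N.
  apply/eqP; rewrite eqn_leq !divn2 addn1 lrank_ge_even // andbT.
  (* This is the least k with n - 2k < d. Since d is even and positive, d >= 2, hence 2k <= n and
     the k disjoint pairs fit. *)
  set k := (n./2 - d./2).+1; have kn : n = (k + (k + (n - k.*2)))%N by rewrite /k; lia.
  have : (lrank (sum_monomials d (k + (k + (n - k.*2)))) <= k)%N.
    by apply: lrank_le_pairs; rewrite -kn /k; lia.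
  by rewrite -kn.
by split=> // pn; rewrite main; lia.
Qed.
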